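(* Let $G(n,1/2)$ be the Erdős–Rényi random graph on $[n]$ with edge probability $\frac12$, fix $\delta\in(1/2,1)$ and a constant $C>0$, and define the events $$\mathcal{A}_{\mathrm d}^{\delta}=\Bigl\{\exists\, v\in[n]:\ \bigl||N_v|-\tfrac n2\bigr|\ge Cn^{\delta}\Bigr\},\qquad \mathcal{A}_{\mathrm{cod}}^{\delta}=\Bigl\{\exists\, v\neq v'\in[n]:\ \bigl||N_v\cap N_{v'}|-\tfrac n4\bigr|\ge Cn^{\delta}\Bigr\}.$$ Let $\mathcal{C}_r$ denote the event that the maximal clique size in $G(n,1/2)$ is greater than or equal to $r$. If $r=cn^{\frac12-\varepsilon}$ for some positive constants $c$ and $\varepsilon$ such that $\delta+\varepsilon>1$, then $$\mathbb{P}\bigl(\mathcal{A}_{\mathrm d}^{\delta}\cup\mathcal{A}_{\mathrm{cod}}^{\delta}\,\big|\,\mathcal{C}_r\bigr)\to0\qquad\text{as }n\to\infty.$$ In particular, there is a constant $C_0'>0$ such that, conditionally on $\mathcal{C}_r$, with high probability as $n\to\infty$ (i.e. in conditional probability), $$\max_{s\le\left((1-\delta)\wedge\frac12\right)\frac{\log n}{\log 2}-C_0'\log\log n}\ \max_{H_s\in\mathcal{G}(s)}\left|\frac{n_{G(n,1/2)}(H_s)}{\frac{(n)_s}{|\mathrm{Aut}(H_s)|}\left(\frac12\right)^{\binom s2}}-1\right|\longrightarrow0 .$$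
   Context: $[n]=\{1,\dots,n\}$; in $G(n,1/2)$ each pair of vertices is joined independently with probability $1/2$. $N_v$ is the set of neighbours of $v$. $\mathcal{G}(s)$ is the set of all graphs with vertex set $[s]$ ($s$ a positive integer); for graphs $G,H$, $n_G(H)$ is the number of induced isomorphic copies of $H$ in $G$ (number of vertex subsets of $G$ inducing a subgraph isomorphic to $H$); $\mathrm{Aut}(H)$ is the automorphism group of $H$; $(n)_s=n(n-1)\cdots(n-s+1)$; $a\wedge b=\min\{a,b\}$; $\log$ is the natural logarithm. *)

(* Defs.v *)
From HB Require Import structures.
From mathcomp Require Import all_boot all_order all_algebra all_fingroup.
From mathcomp Require Import all_classical all_reals all_analysis.

Set Implicit Arguments.
Unset Strict Implicit.
Unset Printing Implicit Defensive.

Import Order.TTheory GRing.Theory Num.Theory.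
Import numFieldNormedType.Exports.

Local Open Scope ring_scope.

Record edge (T : finType) := Edge {
  edge_val :> {set T};
  card_edge : #|edge_val| == 2%N }.
HB.instance Definition _ (T : finType) := [isSub for @edge_val T].
HB.instance Definition _ (T : finType) := [Finite of edge T by <:].

(* A simple graph on T is an arbitrary set of two-element subsets of T; with
   this encoding the finType [graph T] contains each simple graph exactly
   once, so [graph 'I_s] is the set of all graphs on s labelled vertices. *)
Notation graph T := {set edge T}.

Section Graphs.
Variable T : finType.
Implicit Type G : graph T.

Definition adj G : rel T :=
  fun x y => [exists e in G, val e == [set x; y]%SET].

Definition neighbours G (v : T) : {set T} := [set w | adj G v w]%SET.

Definition is_clique G (K : {set T}) : bool :=
  [forall x in K, forall y in K, (x != y) ==> adj G x y].

Definition clique_number G : nat := (\max_(K : {set T} | is_clique G K) #|K|)%N.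

Definition graph_aut G : {set {perm T}} :=
  [set s : {perm T} | [forall x, forall y, adj G (s x) (s y) == adj G x y]]%SET.

End Graphs.

Section Copies.
Variables T W : finType.
Implicit Types (G : graph T) (H : graph W).

(* f is an isomorphism from H onto the subgraph of G induced on U *)
Definition induced_iso G H (U : {set T}) (f : {ffun W -> T}) : bool :=
  [&& injectiveb f, f @: [set: W]%SET == U
    & [forall x, forall y, adj G (f x) (f y) == adj H x y]].

Definition induced_copies G H : nat :=
  #|[set U : {set T} | [exists f : {ffun W -> T}, induced_iso G H U f]]%SET|.

End Copies.

Section ErdosRenyi.
Variables (R : realType) (n : nat).

(* Product law: each pair is an edge independently with probability p. *)
Definition er_weight (p : R) (G : graph 'I_n) : R :=
  \prod_(e : edge 'I_n) (if e \in G then p else 1 - p).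

Definition er_prob (p : R) (A : {set graph 'I_n}) : R :=
  \sum_(G in A) er_weight p G.

(* Equal to 0 when the conditioning event is null, as x / 0 = 0. *)
Definition er_cprob (p : R) (A B : {set graph 'I_n}) : R :=
  er_prob p (A :&: B)%SET / er_prob p B.

Definition deg_event (delta C : R) : {set graph 'I_n} :=
  [set G : graph 'I_n | [exists v,
     C * n%:R `^ delta <= `|#|neighbours G v|%:R - n%:R / 2|]]%SET.

Definition codeg_event (delta C : R) : {set graph 'I_n} :=
  [set G : graph 'I_n | [exists v, exists v', (v != v') &&
     (C * n%:R `^ delta
        <= `|#|(neighbours G v :&: neighbours G v')%SET|%:R - n%:R / 4|)]]%SET.

(* The threshold r is real: it need not be an integer. *)
Definition clique_event (r : R) : {set graph 'I_n} :=
  [set G : graph 'I_n | r <= (clique_number G)%:R]%SET.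

Definition copies_error (G : graph 'I_n) (s : nat) (H : graph 'I_s) : R :=
  `|(induced_copies G H)%:R
      / ((n ^_ s)%:R / #|graph_aut H|%:R * 2^-1 ^+ 'C(s, 2)) - 1|.

(* Maximum over all integers s with 1 <= s <= L (0 if there are none). *)
Definition max_copies_error (L : R) (G : graph 'I_n) : R :=
  \big[Num.max/0]_(1 <= s < (Num.truncn L).+1)
    \big[Num.max/0]_(H : graph 'I_s) copies_error G H.

End ErdosRenyi.

(* Main.v *)
Require Import Defs.
From mathcomp Require Import all_boot all_order all_algebra all_fingroup.
From mathcomp Require Import all_classical all_reals all_analysis.
From mathcomp Require Import ring lra.

(** Fix distinct vertices v_1, ..., v_i and prescribe the adjacency of a further
    vertex to each of them. The number of vertices that comply should be about
    (n - i) / 2 ^ i, and the whole theorem follows from the fact that, even given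
    a clique of size r, all these counts with i <= ln n + 2 are within
    (C / 2) n ^ delta of that value with probability tending to 1. A graph in which
    one of them is not is called irregular below.

    Given a fixed clique K of size k, the edges with an endpoint outside K are still
    fair coins, so the compliant vertices outside K form a sum of independent
    indicators; those inside K change the count by at most k, which is
    o(n ^ delta). An exponential moment bound ([clique_deviates]) makes the
    conditional probability of a deviation at most 2 exp (- (t - k) ^ 2 / (8 n))
    with t = (C / 2) n ^ delta. The event that the clique number is at least k
    is the union over at most n ^ k sets K of the events that K is a clique, and
    each of these is at most as likely as the union. Hence conditioning on the
    union instead of on a fixed K costs only a factor n ^ k
    ([irregular_given_clique]), and the union over the prescriptions costs a
    factor n ^ O (ln n). Altogether the conditional probability of irregularity is
    at most
      exp (O (n ^ max (1/2 - eps, 0) (ln n) ^ 2) - c' n ^ (2 delta - 1)),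
    and 2 delta - 1 > 1/2 - eps because delta > 1/2 and delta + eps > 1
    ([irregular_unlikely]).

    The rest is deterministic. Degrees and codegrees are the counts with i = 1 and
    i = 2. For the induced copies of a graph H on s vertices, embed H one vertex at
    a time: once i vertices are placed, the admissible images of the next one are
    counted by such an extension count. Each step therefore contributes its factor
    (n - i) / 2 ^ i up to a relative error of order n ^ (delta - 1) 2 ^ s. For
    s <= (1 - delta) log_2 n - C0 ln ln n with C0 = 2 / ln 2 this error is
    O ((ln n) ^ -2), and at most ln n steps are taken, so the total relative error is
    O (1 / ln n) ([regular_copies_error], [near_max_copies_error]). *)

Set Implicit Arguments.
Unset Strict Implicit.
Unset Printing Implicit Defensive.

Import Order.TTheory GRing.Theory Num.Theory.
Import numFieldNormedType.Exports.

Local Open Scope classical_set_scope.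
Local Open Scope ring_scope.

(** * Independence for a uniform random subset *)

Section UniformSubset.
Local Open Scope set_scope.
Local Open Scope ring_scope.
Variables (R : realType) (E : finType).
Implicit Types (S G : {set E}) (F g : {set E} -> R).

(** Two independent uniform subsets may exchange their traces on S without
    changing their joint law. The exchange turns F (G) g (G') into F (G) g (G), as F
    does not look at S and g looks only at S. *)
Lemma sum_indep S F g :
    (forall G, F (G :\: S) = F G) -> (forall G, g (G :&: S) = g G) ->
  (\sum_G F G * g G) * #|{set E}|%:R = (\sum_G F G) * (\sum_G g G).
Proof.
move=> FS gS.
pose swap (p : {set E} * {set E}) :=
  ((p.1 :\: S) :|: (p.2 :&: S), (p.2 :\: S) :|: (p.1 :&: S)).
have swapK : involutive swap.
  move=> [G G']; congr pair; apply/setP => e; rewrite !inE /=;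
    by case: (e \in S); rewrite ?andbT ?andbF ?orbF ?orFb.
have FC G G' : F ((G :\: S) :|: (G' :&: S)) = F G.
  rewrite -[LHS]FS -[RHS]FS; congr F; apply/setP => e; rewrite !inE.
  by case: (e \in S); rewrite ?andbF ?orbF ?andbT.
have gC G G' : g ((G' :\: S) :|: (G :&: S)) = g G.
  rewrite -[LHS]gS -[RHS]gS; congr g; apply/setP => e; rewrite !inE.
  by case: (e \in S); rewrite ?andbF ?orbF ?andbT.
rewrite big_distrlr /= pair_bigA /= (reindex_inj (inv_inj swapK)) /=.
under [RHS]eq_bigr => p _ do rewrite FC gC.
rewrite -(pair_bigA _ (fun G _ => F G * g G)) /= mulr_suml.
by apply: eq_bigr => G _; rewrite sumr_const mulr_natr.
Qed.

(** Toggling e pairs the sets that contain e with those that do not. *)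
Lemma sum_edge_half (e : E) (b : bool) :
  (\sum_(G : {set E}) ((e \in G) == b)%:R : R) * 2 = #|{set E}|%:R.
Proof.
pose flip (G : {set E}) := if e \in G then G :\ e else e |: G.
have flipE G : (e \in flip G) = (e \notin G).
  by rewrite /flip; case: ifP => eG; rewrite !inE ?eqxx ?eG.
have flipK : involutive flip.
  move=> G; rewrite {1}/flip flipE /flip; case: (boolP (e \in G)) => eG /=.
    by rewrite finset.setD1K.
  by rewrite finset.setU1K.
rewrite mulr_natr mulr2n {2}(reindex_inj (inv_inj flipK)) -big_split /=.
rewrite (eq_bigr (fun=> 1)) ?sumr_const// => G _.
by rewrite flipE; case: (e \in G); case: b; rewrite /= ?addr0 ?add0r.
Qed.

End UniformSubset.

(** * The edges at a vertex *)

Section Graphs.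
Local Open Scope set_scope.
Local Open Scope ring_scope.
Variables (R : realType) (T : finType).
Implicit Types (G : graph T) (x y v w : T).

Lemma adjC G x y : adj G x y = adj G y x.
Proof. by rewrite /adj; apply: eq_existsb => e; rewrite finset.setUC. Qed.

Lemma adj_irr G x : adj G x x = false.
Proof.
apply/negbTE/negP => /existsP[e /andP[_ /eqP Ee]].
by have := card_edge e; rewrite Ee finset.setUid cards1.
Qed.

Definition star w : {set edge T} := [set e : edge T | w \in val e].

Lemma adj_off_star G w x y : w != x -> w != y -> adj (G :\: star w) x y = adj G x y.
Proof.
move=> wx wy; apply: eq_existsb => e; rewrite !inE.
case: eqP => [->|]; last by rewrite !andbF.
by rewrite !inE (negbTE wx) (negbTE wy).
Qed.

Lemma adj_on_star G w y : adj (G :&: star w) w y = adj G w y.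
Proof.
apply: eq_existsb => e; rewrite !inE.
case: eqP => [->|]; last by rewrite !andbF.
by rewrite !inE eqxx !andbT.
Qed.

Lemma edge_exists x y : x != y -> {e : edge T | val e = [set x; y]}.
Proof.
move=> xy; have c2 : #|[set x; y]| == 2%N by rewrite cards2 xy.
by exists (Edge c2).
Qed.

Lemma adjE G x y (e : edge T) : val e = [set x; y] -> adj G x y = (e \in G).
Proof.
move=> Ee; apply/existsP/idP => [[f /andP[fG /eqP Ef]]|eG].
  by rewrite (_ : e = f)//; apply: val_inj; rewrite Ee Ef.
by exists e; rewrite eG Ee eqxx.
Qed.

(** A list y of pairs (v, b) prescribes an adjacency b to each of its vertices v. *)
Definition sees G (y : seq (T * bool)) w := all (fun q => adj G w q.1 == q.2) y.

Lemma sees_off_star G (y : seq (T * bool)) w v :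
  w != v -> w \notin unzip1 y -> sees (G :\: star w) y v = sees G y v.
Proof.
move=> wv wy; apply: eq_in_all => -[a b] yab /=; rewrite adj_off_star//.
by apply: contra wy => /eqP ->; apply: (map_f fst yab).
Qed.

Lemma sees_on_star G (y : seq (T * bool)) w : sees (G :&: star w) y w = sees G y w.
Proof. by apply: eq_in_all => -[a b] yab /=; rewrite adj_on_star. Qed.

Lemma is_clique_off_star G (K : {set T}) w :
  w \notin K -> is_clique (G :\: star w) K = is_clique G K.
Proof.
move=> wK; have wz z : z \in K -> w != z by apply: contraTneq => <-.
apply: eq_forallb => x; case: (boolP (x \in K)) => //= xK.
by apply: eq_forallb => z; case: (boolP (z \in K)) => //= zK; rewrite adj_off_star ?wz.
Qed.

(** The edges from w to distinct vertices are independent fair coins, so each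
    constraint in y halves the number of graphs. *)
Lemma sees_half w (y : seq (T * bool)) :
    w \notin unzip1 y -> uniq (unzip1 y) ->
  (\sum_(G : graph T) (sees G y w)%:R : R) = #|{set edge T}|%:R / 2 ^+ size y.
Proof.
elim: y => [_ _|[a b] y IH] /=.
  by rewrite (eq_bigr (fun=> 1)) ?sumr_const ?expr0 ?divr1.
rewrite inE negb_or => /andP[wa wy] /andP[ay uy].
have [e Ee] := edge_exists wa.
have c0 : #|{set edge T}|%:R != 0 :> R.
  by rewrite pnatr_eq0 -lt0n; apply/card_gt0P; exists finset.set0.
apply: (mulIf c0).
rewrite (eq_bigr (fun G => (sees G y w)%:R * ((e \in G) == b)%:R)); last first.
  by move=> G _; rewrite (adjE G Ee) andbC -mulnb natrM.
rewrite (sum_indep (S := [set e])) => [|G|G]; last 2 first.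
- congr (_%:R); congr (nat_of_bool _); apply: eq_in_all => -[a' b'] /= ya'.
  have aa' : a' != a.
    by apply: contra ay => /eqP <-; apply: (map_f fst ya').
  have wa' : w != a'.
    by apply: contra wy => /eqP ->; apply: (map_f fst ya').
  have [e' Ee'] := edge_exists wa'.
  rewrite !(adjE _ Ee') !inE; case: (e' =P e) => //= ee'.
  have : a' \in val e by rewrite -ee' Ee' !inE eqxx orbT.
  by rewrite Ee !inE eq_sym (negbTE wa') (negbTE aa').
- by rewrite !inE eqxx andbT.
rewrite IH// exprS invfM -(sum_edge_half R e b); field.
by rewrite expf_neq0// pnatr_eq0.
Qed.

End Graphs.

(** * Tail bounds in the presence of a clique *)

Section Chernoff.
Local Open Scope set_scope.
Local Open Scope ring_scope.
Variable (R : realType).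

Lemma expR_le_quad (x : R) : x <= 2^-1 -> expR x <= 1 + x + 2 * x ^+ 2.
Proof.
move=> x2; have ex : expR x * expR (- x) = 1 by rewrite expRN mulfV// gt_eqF ?expR_gt0.
have e0 := expR_gt0 x; have := expR_ge1Dx (- x) => e1.
have h : expR x * (1 - x) <= 1 by rewrite -[leRHS]ex ler_wpM2l ?expR_ge0.
rewrite -(@ler_pM2r _ (1 - x)); last by lra.
apply: le_trans h _.
have -> : (1 + x + 2 * x ^+ 2) * (1 - x) = 1 + x ^+ 2 * (1 - 2 * x) by ring.
by rewrite lerDl mulr_ge0 ?sqr_ge0//; lra.
Qed.

(** A form of Hoeffding's lemma: in the second-order expansion the linear terms
    cancel, since the variable is centred. The constant 2 instead of 1/8 is harmless
    here. *)
Lemma bernoulli_mgf (q l : R) : 0 <= q -> q <= 1 -> `|l| <= 2^-1 ->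
  q * expR (l * (1 - q)) + (1 - q) * expR (l * (0 - q)) <= expR (2 * l ^+ 2).
Proof.
move=> q0 q1; rewrite ler_norml => /andP[l1 l2].
have h1 : expR (l * (1 - q)) <= 1 + l * (1 - q) + 2 * (l * (1 - q)) ^+ 2.
  by apply: expR_le_quad; nra.
have h2 : expR (l * (0 - q)) <= 1 + l * (0 - q) + 2 * (l * (0 - q)) ^+ 2.
  by apply: expR_le_quad; nra.
apply: le_trans (expR_ge1Dx _).
apply: le_trans (lerD (ler_wpM2l q0 h1) (ler_wpM2l _ h2)) _; first by lra.
rewrite -subr_ge0 [leRHS](_ : _ = 2 * l ^+ 2 * (1 - q * (1 - q))); last by ring.
apply: mulr_ge0; first by rewrite mulr_ge0 ?sqr_ge0.
by rewrite subr_ge0 mulr_ile1//; lra.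
Qed.

Variable (T : finType).
Implicit Types (G : graph T) (K : {set T}) (y : seq (T * bool)) (ws : seq T).

Definition sees_dev y G w : R := (sees G y w)%:R - 2^-1 ^+ size y.

Lemma tilted_sum (l : R) y w :
    w \notin unzip1 y -> uniq (unzip1 y) -> `|l| <= 2^-1 ->
  \sum_(G : graph T) expR (l * sees_dev y G w)
    <= expR (2 * l ^+ 2) * #|{set edge T}|%:R.
Proof.
move=> wy uy l2; set q : R := 2^-1 ^+ size y.
have q0 : 0 <= q by rewrite exprn_ge0// invr_ge0.
have q1 : q <= 1 by rewrite exprn_ile1// ?invr_ge0//; lra.
rewrite (eq_bigr (fun G => (sees G y w)%:R * (expR (l * (1 - q)) - expR (l * (0 - q)))
   + expR (l * (0 - q)))); last first.
  by move=> G _; rewrite /sees_dev -/q; case: (sees G y w); rewrite /=; ring.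
rewrite big_split /= -mulr_suml sees_half// sumr_const.
apply: le_trans (ler_wpM2r _ (bernoulli_mgf q0 q1 l2)); last exact: ler0n.
by rewrite -mulr_natr -[X in X <= _]/(_) /q exprVn; lra.
Qed.

(** The vertices of ws lie outside both K and the constrained vertices, so the
    stars of these vertices carry neither an edge inside K nor an edge used by another
    vertex of ws: the vertices of ws can be integrated out one at a time. *)
Lemma clique_mgf (l : R) K y ws :
    uniq (unzip1 y) -> `|l| <= 2^-1 -> uniq ws ->
    {in ws, forall w, (w \notin K) && (w \notin unzip1 y)} ->
  \sum_(G : graph T) (is_clique G K)%:R * \prod_(w <- ws) expR (l * sees_dev y G w)
    <= expR (2 * l ^+ 2) ^+ size ws * \sum_(G : graph T) (is_clique G K)%:R.
Proof.
move=> uy l2; elim: ws => [_ _|w ws IH] /=.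
  by rewrite expr0 mul1r; apply: ler_sum => G _; rewrite big_nil mulr1.
move=> /andP[wws uws] wsP.
have /andP[wK wy] : (w \notin K) && (w \notin unzip1 y) by apply: wsP; rewrite mem_head.
have {}IH := IH uws (fun v vws => wsP v (mem_behead (s := w :: ws) vws)).
have c0 : 0 < #|{set edge T}|%:R :> R.
  by rewrite ltr0n; apply/card_gt0P; exists finset.set0.
rewrite -(ler_pM2r c0).
pose F G : R := (is_clique G K)%:R * \prod_(v <- ws) expR (l * sees_dev y G v).
rewrite (eq_bigr (fun G => F G * expR (l * sees_dev y G w))); last first.
  by move=> G _; rewrite big_cons /F; ring.
rewrite (sum_indep (S := star w)) => [|G|G].
- rewrite exprSr -mulrA [X in _ <= X](_ : _ =
    (expR (2 * l ^+ 2) ^+ size ws * \sum_G (is_clique G K)%:R) *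
      (expR (2 * l ^+ 2) * #|{set edge T}|%:R)); last by ring.
  apply: ler_pM => //; last exact: tilted_sum.
    by apply: sumr_ge0 => G _; rewrite mulr_ge0 ?prodr_ge0// => *; exact: expR_ge0.
  by apply: sumr_ge0 => G _; exact: expR_ge0.
- rewrite /F is_clique_off_star//; congr (_ * _); apply: eq_big_seq => v vws.
  by rewrite /sees_dev sees_off_star//; apply: contra wws => /eqP ->.
- by rewrite /sees_dev sees_on_star.
Qed.

(** Chernoff's bound. The sign of l selects the upper or the lower tail. *)
Lemma clique_tail_one (l u : R) K y ws :
    uniq (unzip1 y) -> `|l| <= 2^-1 -> uniq ws ->
    {in ws, forall w, (w \notin K) && (w \notin unzip1 y)} ->
  \sum_(G : graph T) (is_clique G K && (u <= l * \sum_(w <- ws) sees_dev y G w))%:R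
    <= expR (2 * l ^+ 2 * (size ws)%:R - u) * \sum_(G : graph T) (is_clique G K)%:R.
Proof.
move=> uy l2 uws wsP.
rewrite expRD expRM_natr mulrAC.
apply: le_trans (ler_wpM2r (expR_ge0 _) (clique_mgf uy l2 uws wsP)).
rewrite mulr_suml; apply: ler_sum => G _; rewrite -expR_sum -mulrA -expRD -mulr_sumr.
case: (is_clique G K); rewrite /= ?mul0r// mul1r.
case: (leP u _) => /= h; last exact: expR_ge0.
by rewrite -[leLHS]expR0 ler_expR subr_ge0.
Qed.

Lemma clique_tail (v : R) (N : nat) K y ws :
    (0 < N)%N -> (size ws <= N)%N -> 0 <= v -> v <= 2 * N%:R ->
    uniq (unzip1 y) -> uniq ws ->
    {in ws, forall w, (w \notin K) && (w \notin unzip1 y)} ->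
  \sum_(G : graph T) (is_clique G K && (v <= `|\sum_(w <- ws) sees_dev y G w|))%:R
    <= 2 * expR (- (v ^+ 2 / (8 * N%:R))) * \sum_(G : graph T) (is_clique G K)%:R.
Proof.
move=> N0 sN v0 vN uy uws wsP.
have N0R : 0 < N%:R :> R by rewrite ltr0n.
(* This l minimises 2 l ^ 2 N - l v. *)
pose l := v / (4 * N%:R); pose u := v ^+ 2 / (4 * N%:R).
have l0 : 0 <= l by rewrite divr_ge0//; lra.
have l2 : l <= 2^-1 by rewrite ler_pdivrMr; lra.
have bnd : 2 * l ^+ 2 * (size ws)%:R - u <= - (v ^+ 2 / (8 * N%:R)).
  have -> : - (v ^+ 2 / (8 * N%:R)) = 2 * l ^+ 2 * N%:R - u.
    by rewrite /l /u; field; rewrite gt_eqF.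
  by rewrite lerB// ler_wpM2l ?ler_nat// mulr_ge0 ?sqr_ge0.
have S0 : 0 <= \sum_(G : graph T) (is_clique G K)%:R :> R by apply: sumr_ge0.
have tail l' : `|l'| = l ->
    \sum_(G : graph T) (is_clique G K && (u <= l' * \sum_(w <- ws) sees_dev y G w))%:R
    <= expR (- (v ^+ 2 / (8 * N%:R))) * \sum_(G : graph T) (is_clique G K)%:R.
  move=> ll; have l'2 : `|l'| <= 2^-1 by rewrite ll.
  apply: le_trans (clique_tail_one u uy l'2 uws wsP) _.
  by rewrite ler_wpM2r// ler_expR -[l' ^+ 2]real_normK ?num_real// ll.
have t1 := tail l (ger0_norm l0).
have t2 : `|- l| = l by rewrite normrN ger0_norm.
have {}t2 := tail _ t2.
rewrite -mulrA mulr_natl mulr2n; apply: le_trans (lerD t1 t2).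
rewrite -big_split /=; apply: ler_sum => G _.
case: (is_clique G K); rewrite /= ?addr0//; set D := \sum_(w <- ws) _.
have uE : u = l * v by rewrite /u /l; field; rewrite gt_eqF.
rewrite uE; case: (leP v `|D|) => /= vD; last by rewrite addr_ge0.
have [D0|D0] := leP 0 D.
  by rewrite ger0_norm// in vD; rewrite ler_wpM2l//= lerDl.
rewrite ltr0_norm// in vD; have -> : l * v <= - l * D by rewrite mulNr -mulrN ler_wpM2l.
by rewrite lerDr.
Qed.

Definition extensions G y : {set T} :=
  [set w | (w \notin unzip1 y) && sees G y w].

Definition deviates (t : R) G y : bool :=
  t <= `|#|extensions G y|%:R - (#|T|%:R - (size y)%:R) * 2^-1 ^+ size y|.

(** The constraints are imposed outside [unzip1 y] only. Among those vertices, the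
    ones of K are the only ones missing from the sum, and each of them contributes at
    most 1 in absolute value. *)
Lemma extensions_dev G K y : uniq (unzip1 y) ->
  `|#|extensions G y|%:R - (#|T|%:R - (size y)%:R) * 2^-1 ^+ size y
    - \sum_(w <- enum (~: (K :|: [set x in unzip1 y]))) sees_dev y G w| <= #|K|%:R.
Proof.
move=> uy; set q : R := 2^-1 ^+ size y.
have q0 : 0 <= q by rewrite exprn_ge0// invr_ge0.
have q1 : q <= 1 by rewrite exprn_ile1// ?invr_ge0//; lra.
have -> : #|extensions G y|%:R - (#|T|%:R - (size y)%:R) * q
    = \sum_(w | w \notin unzip1 y) sees_dev y G w.
  rewrite /sees_dev -/q big_split /= sumr_const.
  have -> : \sum_(w | w \notin unzip1 y) (sees G y w)%:R = #|extensions G y|%:R :> R.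
    rewrite -sum1_card natr_sum.
    rewrite [RHS](eq_bigl (fun w => (w \notin unzip1 y) && sees G y w));
      last by move=> w; rewrite inE.
    by rewrite big_mkcondr; apply: eq_bigr => w _; case: (sees G y w).
  have -> : #|[pred w | w \notin unzip1 y]| = (#|T| - size y)%N.
    by rewrite -(cardC [in unzip1 y]) (card_uniqP uy) size_map addKn.
  rewrite mulNrn -[q *+ _]mulr_natl natrB// -(size_map fst) -(card_uniqP uy).
  exact: max_card.
rewrite (bigID (mem K)) /= big_enum /= [X in _ + X - _](_ : _ =
   \sum_(w in ~: (K :|: [set x in unzip1 y])) sees_dev y G w).
  rewrite addrK; apply: le_trans (ler_norm_sum _ _ _) _.
  rewrite -sum1_card natr_sum big_mkcondl; apply: ler_sum => w wK.
  case: ifP => // _; rewrite /sees_dev -/q ler_norml.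
  by case: (sees G y w) => /=; apply/andP; split; lra.
by apply: eq_bigl => w; rewrite !inE negb_or andbC.
Qed.

Lemma clique_deviates (t : R) K y :
    (0 < #|T|)%N -> uniq (unzip1 y) ->
    #|K|%:R <= t -> t - #|K|%:R <= 2 * #|T|%:R ->
  \sum_(G : graph T) (is_clique G K && deviates t G y)%:R
    <= 2 * expR (- ((t - #|K|%:R) ^+ 2 / (8 * #|T|%:R)))
       * \sum_(G : graph T) (is_clique G K)%:R.
Proof.
move=> T0 uy kt tk; pose ws := enum (~: (K :|: [set x in unzip1 y])).
have v0 : 0 <= t - #|K|%:R by lra.
have sws : (size ws <= #|T|)%N by rewrite -cardE max_card.
have wsP : {in ws, forall w, (w \notin K) && (w \notin unzip1 y)}.
  by move=> w; rewrite mem_enum !inE negb_or.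
apply: le_trans (clique_tail T0 sws v0 tk uy (enum_uniq _) wsP).
apply: ler_sum => G _; case: (is_clique G K) => //=.
rewrite ler_nat; case: (boolP (deviates t G y)) => //= dev.
have := extensions_dev G K uy; rewrite -/ws; move: dev; rewrite /deviates.
set A := _ - _ * _; set D := \sum_(w <- _) _ => dev ADK.
suff -> : t - #|K|%:R <= `|D| by [].
by have := ler_normD (A - D) D; rewrite subrK; lra.
Qed.

End Chernoff.

(** * Conditioning on the clique number *)

Section Conditioning.
Local Open Scope set_scope.
Local Open Scope ring_scope.
Variables (R : realType) (T : finType).
Implicit Types (G : graph T) (K : {set T}).

Lemma clique_number_geP G k :
  reflect (exists2 K, is_clique G K & #|K| = k) (k <= clique_number G)%N.
Proof.
apply: (iffP idP) => [|[K cK <-]]; last exact: leq_bigmax_cond.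
have c0 : (0 < #|is_clique G|)%N.
  apply/card_gt0P; exists finset.set0; apply/forallP => x.
  by rewrite inE.
have [K cK KE] := eq_bigmax_cond (fun K : {set T} => #|K|) c0.
have -> : clique_number G = #|K| by exact: KE.
move=> kK; exists [set x in take k (enum K)].
  apply/forallP => x; apply/implyP; rewrite inE => /mem_take; rewrite mem_enum => xK.
  apply/forallP => z; apply/implyP; rewrite inE => /mem_take; rewrite mem_enum => zK.
  by move/forallP/(_ x)/implyP/(_ xK)/forallP/(_ z)/implyP/(_ zK): cK.
rewrite cardsE (card_uniqP _) ?take_uniq ?enum_uniq//.
by rewrite size_takel// -cardE.
Qed.

Lemma bin_le_exp n k : ('C(n, k) <= n ^ k)%N.
Proof.
apply: (@leq_trans (n ^_ k)); first by rewrite -bin_ffact leq_pmulr// fact_gt0.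
elim: k => // k IH; rewrite ffactnSr expnSr leq_mul//.
exact: leq_subr.
Qed.

(** The length of the constraint list is bounded by m so that there are at most
    (m + 1) (2 #|T|) ^ m lists to sum over. *)
Definition irregular (t : R) m G : bool :=
  [exists i : 'I_m.+1, [exists y : i.-tuple (T * bool),
     uniq (unzip1 y) && deviates t G y]].

Lemma irregularPn t m G (y : seq (T * bool)) :
  ~~ irregular t m G -> (size y <= m)%N -> uniq (unzip1 y) ->
  `|#|extensions G y|%:R - (#|T|%:R - (size y)%:R) * 2^-1 ^+ size y| < t.
Proof.
move=> nirr ym uy; rewrite ltNge; apply: contra nirr => dev.
apply/existsP; exists (Ordinal (ym : (size y < m.+1)%N)).
by apply/existsP; exists (in_tuple y); rewrite uy.
Qed.

(** Union bound over the cliques K of size k and over the constraint lists. For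
    each K the tail bound is relative to the number of graphs in which K is a clique,
    which is at most the number of graphs with clique number at least k; this keeps
    the estimate relative to the conditioning event, however rare it is. *)
Lemma irregular_given_clique (t : R) m k :
    (0 < #|T|)%N -> k%:R <= t -> t - k%:R <= 2 * #|T|%:R ->
  \sum_(G : graph T) ((k <= clique_number G)%N && irregular t m G)%:R
    <= (m.+1 * (#|T| * 2) ^ m * #|T| ^ k)%:R
       * (2 * expR (- ((t - k%:R) ^+ 2 / (8 * #|T|%:R))))
       * \sum_(G : graph T) (k <= clique_number G)%:R.
Proof.
move=> T0 kt tk; set b := 2 * expR _; set S := \sum_(G : graph T) (_ <= _)%:R.
have b0 : 0 <= b by rewrite mulr_ge0// expR_ge0.
have S0 : 0 <= S by apply: sumr_ge0.
apply: (@le_trans _ _ (\sum_(G : graph T) \sum_(K : {set T} | #|K| == k)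
   \sum_(i < m.+1) \sum_(y : i.-tuple (T * bool) | uniq (unzip1 y))
     (is_clique G K && deviates t G y)%:R)).
  apply: ler_sum => G _; case: andP => [[/clique_number_geP[K cK /eqP Kk]]|_]; last first.
    by do 3!(apply: sumr_ge0 => ? _).
  move=> /existsP[i /existsP[y /andP[uy dev]]].
  rewrite (bigD1 K)//= (bigD1 i)//= (bigD1 y)//= cK dev -!addrA lerDl.
  by rewrite !addr_ge0//; do ?[apply: sumr_ge0 => ? _]; rewrite ?ler0n.
rewrite exchange_big /=.
under eq_bigr => K _ do (rewrite exchange_big /=;
  under eq_bigr => i _ do rewrite exchange_big /=).
have bound K (i : 'I_m.+1) : #|K| == k ->
    \sum_(y : i.-tuple (T * bool) | uniq (unzip1 y))
      \sum_(G : graph T) (is_clique G K && deviates t G y)%:R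
    <= ((#|T| * 2) ^ m)%:R * (b * S).
  move=> /eqP Kk.
  apply: (@le_trans _ _ (\sum_(y : i.-tuple (T * bool)) b * S)).
    rewrite big_mkcond /=; apply: ler_sum => y _; case: ifP => uy; last exact: mulr_ge0.
    have := @clique_deviates R T t K y T0 uy; rewrite Kk => /(_ kt tk) h.
    apply: le_trans h _; rewrite ler_wpM2l// ler_sum// => G _.
    rewrite ler_nat; case: (boolP (is_clique G K)) => //= cK.
    by rewrite lt0b; apply/clique_number_geP; exists K.
  rewrite sumr_const -[(b * S) *+ _]mulr_natl ler_wpM2r ?mulr_ge0// ler_nat.
  rewrite card_tuple card_prod card_bool.
  by rewrite leq_pexp2l ?muln_gt0 ?T0//= -ltnS.
apply: (@le_trans _ _ (\sum_(K : {set T} | #|K| == k) \sum_(i < m.+1)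
  ((#|T| * 2) ^ m)%:R * (b * S))).
  by apply: ler_sum => K Kk; apply: ler_sum => i _; exact: bound.
clearbody b.
rewrite !sumr_const card_ord -[_ *+ m.+1]mulr_natl -[_ *+ #|_|]mulr_natl.
rewrite [X in X%:R * _](_ : _ = 'C(#|T|, k)); last by rewrite -card_draws cardsE.
rewrite !mulrA -!natrM -!(mulrA _ b) ler_wpM2r ?mulr_ge0// ler_nat.
by rewrite -mulnA mulnC leq_mul// bin_le_exp.
Qed.

Lemma sum_natr_card (P : pred (graph T)) :
  \sum_(G : graph T) (P G)%:R = #|[set G | P G]|%:R :> R.
Proof.
rewrite -sum1_card natr_sum [RHS]big_mkcond /=; apply: eq_bigr => G _.
by rewrite inE; case: (P G).
Qed.

End Conditioning.

Section UniformLaw.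
Local Open Scope set_scope.
Local Open Scope ring_scope.
Variables (R : realType) (n : nat).

(** At p = 1/2 all graphs have the same weight, so conditional probabilities are
    ratios of cardinals. *)
Lemma er_cprob_half (A B : {set graph 'I_n}) :
  er_cprob 2^-1 A B = #|A :&: B|%:R / #|B|%:R :> R.
Proof.
have wE (G : graph 'I_n) : er_weight 2^-1 G = 2^-1 ^+ #|{: edge 'I_n}| :> R.
  rewrite /er_weight (eq_bigr (fun=> 2^-1)) ?prodr_const// => e _.
  by case: ifP => // _; lra.
have pE (D : {set graph 'I_n}) : er_prob 2^-1 D = #|D|%:R * 2^-1 ^+ #|{: edge 'I_n}| :> R.
  by rewrite /er_prob (eq_bigr (fun=> 2^-1 ^+ #|{: edge 'I_n}|)) ?sumr_const ?mulr_natl.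
rewrite /er_cprob !pE -mulf_div divff ?mulr1// expf_neq0//.
Qed.

Lemma exists_nat_ceil (r : R) : 0 <= r -> exists2 k : nat, r <= k%:R & k%:R < r + 1.
Proof.
move=> r0; have /andP[h1 h2] := truncn_itv r0.
have [rE|rn] := eqVneq r (Num.truncn r)%:R.
  by exists (Num.truncn r); rewrite -rE// ltrDl.
exists (Num.truncn r).+1; first exact: ltW.
by rewrite -natr1 ltrD2r lt_neqAle eq_sym rn.
Qed.

Lemma cprob_irregular (t r : R) m k :
    (0 < n)%N -> r <= k%:R -> k%:R < r + 1 ->
    k%:R <= t -> t - k%:R <= 2 * n%:R ->
  er_cprob 2^-1 [set G | irregular t m G] (clique_event n r)
    <= (m.+1 * (n * 2) ^ m * n ^ k)%:R * (2 * expR (- ((t - k%:R) ^+ 2 / (8 * n%:R)))).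
Proof.
move=> n0 rk kr kt tk; rewrite er_cprob_half.
have crE : clique_event n r = [set G | (k <= clique_number G)%N].
  apply/setP => G; rewrite !inE; apply/idP/idP => h.
    by rewrite -ltnS -(ltr_nat R); apply: lt_le_trans kr _; rewrite -natr1 lerD2r.
  by apply: le_trans rk _; rewrite ler_nat.
have := @irregular_given_clique R 'I_n t m k; rewrite !card_ord => /(_ n0 kt tk).
rewrite !sum_natr_card -crE.
have -> : [set G | (k <= clique_number G)%N && irregular t m G] =
    [set G | irregular t m G] :&: clique_event n r.
  by rewrite crE; apply/setP => G; rewrite !inE andbC.
set N := #|clique_event n r|; set M := #|_ :&: _|; set B := _ * (2 * _) => h.
have [N0|N0] := posnP N.
  rewrite N0 invr0 mulr0 /B !mulr_ge0//; exact: expR_ge0.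
by rewrite ler_pdivrMr ?ltr0n.
Qed.

End UniformLaw.

(** * Degrees and induced copies in graphs that are not irregular *)

Section Degrees.
Local Open Scope set_scope.
Local Open Scope ring_scope.
Variables (R : realType) (n : nat).
Implicit Types (G : graph 'I_n).

Lemma neighbours_extensions G v : neighbours G v = extensions G [:: (v, true)].
Proof.
apply/setP => w; rewrite !inE /= andbT eqb_id adjC.
by case: eqP => [->|]; rewrite ?adj_irr.
Qed.

Lemma common_neighbours_extensions G v v' :
  neighbours G v :&: neighbours G v' = extensions G [:: (v, true); (v', true)].
Proof.
apply/setP => w; rewrite !inE /= andbT !eqb_id (adjC _ v) (adjC _ v').
case: (w =P v) => [->|_] /=; first by rewrite adj_irr.
by case: (w =P v') => [->|_] /=; rewrite ?adj_irr ?andbF.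
Qed.

(** The slack 1 in the hypothesis absorbs the difference between (n - 1) / 2 and
    n / 2, and between (n - 2) / 4 and n / 4. *)
Lemma regular_degrees (delta C t : R) m G :
    t + 1 <= C * n%:R `^ delta -> (1 < m)%N -> ~~ irregular t m G ->
  G \notin (deg_event n delta C :|: codeg_event n delta C).
Proof.
move=> tC m1 reg; rewrite !inE negb_or; apply/andP; split.
  apply/existsPn => v; rewrite -ltNge.
  have := irregularPn (y := [:: (v, true)]) reg (ltnW m1) isT.
  rewrite -neighbours_extensions card_ord /= expr1.
  by set x := #|_|%:R; rewrite ltr_norml => h; rewrite ltr_norml; lra.
apply/existsPn => v; apply/existsPn => v'; rewrite negb_and -implybE; apply/implyP => vv'.
rewrite -ltNge.
have := irregularPn (y := [:: (v, true); (v', true)]) reg m1.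
rewrite -common_neighbours_extensions card_ord /= inE vv' => /(_ isT).
by set x := #|_|%:R; rewrite ltr_norml => h; rewrite ltr_norml; lra.
Qed.

End Degrees.

Section Embeddings.
Local Open Scope set_scope.
Local Open Scope ring_scope.
Variables (T : finType).
Implicit Types (G : graph T).

(** H is replaced by an arbitrary relation h, so that the induction can drop a
    vertex of H by restricting h. *)
Definition embeds G s (h : rel 'I_s) (f : {ffun 'I_s -> T}) : bool :=
  injectiveb f && [forall a, forall b, adj G (f a) (f b) == h a b].

Definition ffun_cons s (w : T) (f : {ffun 'I_s -> T}) : {ffun 'I_s.+1 -> T} :=
  [ffun a => if unlift ord0 a is Some b then f b else w].

Definition rel_behead s (h : rel 'I_s.+1) : rel 'I_s :=
  fun a b => h (lift ord0 a) (lift ord0 b).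

(** What the image of vertex 0 has to satisfy once the other vertices are placed
    by f. *)
Definition pattern s (h : rel 'I_s.+1) (f : {ffun 'I_s -> T}) : seq (T * bool) :=
  [seq (f a, h ord0 (lift ord0 a)) | a <- enum 'I_s].

Lemma size_pattern s (h : rel 'I_s.+1) (f : {ffun 'I_s -> T}) : size (pattern h f) = s.
Proof. by rewrite size_map size_enum_ord. Qed.

Lemma unzip1_pattern s (h : rel 'I_s.+1) (f : {ffun 'I_s -> T}) :
  unzip1 (pattern h f) = codom f.
Proof. by rewrite /unzip1 -map_comp codomE. Qed.

Lemma embeds_cons G s (h : rel 'I_s.+1) w f :
    symmetric h -> irreflexive h ->
  embeds G h (ffun_cons w f)
    = embeds G (rel_behead h) f && (w \in extensions G (pattern h f)).
Proof.
move=> hS hI.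
have c0 : ffun_cons w f ord0 = w by rewrite ffunE unlift_none.
have cS a : ffun_cons w f (lift ord0 a) = f a by rewrite ffunE liftK.
rewrite inE unzip1_pattern; apply/andP/andP.
  move=> [/injectiveP inj /forallP adjh]; have {}adjh a b := eqP (forallP (adjh a) b).
  split; apply/andP; split.
  - by apply/injectiveP => a b fab; apply: (@lift_inj _ ord0); apply: inj; rewrite !cS.
  - by apply/forallP => a; apply/forallP => b; rewrite -(cS a) -(cS b) adjh.
  - apply/codomP => -[a wa]; have /inj : ffun_cons w f ord0 = ffun_cons w f (lift ord0 a).
      by rewrite c0 cS.
    by move/eqP; rewrite (negbTE (neq_lift _ _)).
  - by apply/allP => _ /mapP[a _ ->] /=; rewrite -(adjh ord0) c0 cS.
move=> [/andP[/injectiveP inj /forallP adjh] /andP[wf /allP ext]].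
have {}adjh a b := eqP (forallP (adjh a) b).
have {}ext a : adj G w (f a) = h ord0 (lift ord0 a).
  apply: (eqP (ext (f a, h ord0 (lift ord0 a)) _)).
  by apply/mapP; exists a; rewrite ?mem_enum.
split.
  apply/injectiveP => a b.
  case: (unliftP ord0 a) => [a'|] ->; case: (unliftP ord0 b) => [b'|] -> //; rewrite ?c0 ?cS.
  - by move/inj ->.
  - by move=> fw; case/codomP: wf; exists a'.
  - by move=> fw; case/codomP: wf; exists b'.
apply/forallP => a; apply/forallP => b.
case: (unliftP ord0 a) => [a'|] ->; case: (unliftP ord0 b) => [b'|] ->; rewrite ?c0 ?cS.
- by rewrite adjh.
- by rewrite adjC ext hS.
- by rewrite ext.
- by rewrite adj_irr hI.
Qed.

Lemma sum_ffun_cons (R : nmodType) s (F : {ffun 'I_s.+1 -> T} -> R) :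
  \sum_f F f = \sum_(f : {ffun 'I_s -> T}) \sum_w F (ffun_cons w f).
Proof.
rewrite pair_bigA /= (reindex (fun p => ffun_cons p.2 p.1))//=.
exists (fun f : {ffun 'I_s.+1 -> T} => ([ffun a => f (lift ord0 a)], f ord0)) => [[f w] _|f _] /=.
  by congr pair; [apply/ffunP => a; rewrite !ffunE liftK | rewrite ffunE unlift_none].
by apply/ffunP => a; rewrite ffunE; case: unliftP => [b|] ->; rewrite ?ffunE.
Qed.

Variable R : realType.

Lemma sum_embeds_cons G s (h : rel 'I_s.+1) :
    symmetric h -> irreflexive h ->
  \sum_f (embeds G h f)%:R
    = \sum_(f | embeds G (rel_behead h) f) #|extensions G (pattern h f)|%:R :> R.
Proof.
move=> hS hI; rewrite sum_ffun_cons [RHS]big_mkcond /=; apply: eq_bigr => f _.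
under eq_bigr => w _ do rewrite embeds_cons//.
case: (embeds G _ f) => /=; last by rewrite big1.
rewrite -sum1_card natr_sum [RHS]big_mkcond /=; apply: eq_bigr => w _.
by case: (w \in _).
Qed.

Definition expected_embeddings s : R := (#|T| ^_ s)%:R * 2^-1 ^+ 'C(s, 2).

Lemma expected_embeddingsS s : (s <= #|T|)%N ->
  expected_embeddings s.+1 =
    expected_embeddings s * ((#|T|%:R - s%:R) * 2^-1 ^+ s).
Proof.
by move=> sT; rewrite /expected_embeddings ffactnSr natrM natrB// binS bin1 exprD; ring.
Qed.

Lemma expected_embeddings_gt0 s : (s <= #|T|)%N -> 0 < expected_embeddings s.
Proof. by move=> sT; rewrite mulr_gt0 ?exprn_gt0 ?invr_gt0// ltr0n ffact_gt0. Qed.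

(** Induction on s: by [sum_embeds_cons] each embedding of H minus a vertex has as
    many extensions as its pattern has compliant vertices, and regularity puts this
    number within a factor 1 - eta, 1 + eta of (#|T| - s) / 2 ^ s. *)
Lemma embeddings_bounds (t eta : R) m G s (h : rel 'I_s) :
    ~~ irregular t m G -> 0 <= eta -> eta <= 1 ->
    (forall i, (i < s)%N -> t <= eta * ((#|T|%:R - i%:R) * 2^-1 ^+ i)) ->
    (s <= m.+1)%N -> (s <= #|T|)%N -> symmetric h -> irreflexive h ->
  expected_embeddings s * (1 - eta) ^+ s <= \sum_f (embeds G h f)%:R
    <= expected_embeddings s * (1 + eta) ^+ s.
Proof.
move=> reg e0 e1; elim: s h => [|s IH] h tP sm sT hS hI.
  have -> : \sum_f (embeds G h f)%:R = 1 :> R.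
    have emb f : embeds G h f.
      by apply/andP; split; [apply/injectiveP => -[] | apply/forallP => -[]].
    rewrite (eq_bigr (fun=> 1)) => [|f _]; last by rewrite emb.
    by rewrite sumr_const card_ffun card_ord expn0.
  by rewrite /expected_embeddings !expr0 ffactn0 !mulr1 lexx.
have /andP[lo hi] := IH (rel_behead h) (fun i si => tP i (ltnW si)) (ltnW sm) (ltnW sT)
  (fun a b => hS _ _) (fun a => hI _).
have mu0 := expected_embeddings_gt0 (ltnW sT).
have := tP s (ltnSn s); set d := _ * 2^-1 ^+ s => td.
have d0 : 0 <= d by rewrite mulr_ge0 ?exprn_ge0 ?invr_ge0// subr_ge0 ler_nat ltnW.
have ext f : embeds G (rel_behead h) f ->
    d * (1 - eta) <= #|extensions G (pattern h f)|%:R <= d * (1 + eta).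
  move=> /andP[/injectiveP inj _].
  have := irregularPn (y := pattern h f) reg.
  rewrite size_pattern unzip1_pattern => /(_ sm) /(_ (introT (injectiveP f) inj)).
  by rewrite -/d ltr_norml => /andP[h1 h2]; apply/andP; split; lra.
rewrite sum_embeds_cons// expected_embeddingsS ?(ltnW sT)// -/d.
move: lo hi; set S := \sum_f _ => lo hi.
have SE c : S * c = \sum_(f | embeds G (rel_behead h) f) c.
  rewrite [RHS]big_mkcond mulr_suml; apply: eq_bigr => f _.
  by case: ifP; rewrite ?mul1r ?mul0r.
apply/andP; split.
  apply: (@le_trans _ _ (S * (d * (1 - eta)))).
    rewrite exprSr mulrACA ler_wpM2r//.
    by rewrite mulr_ge0// subr_ge0.
  by rewrite SE; apply: ler_sum => f /ext /andP[].
apply: (@le_trans _ _ (S * (d * (1 + eta)))).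
  by rewrite SE; apply: ler_sum => f /ext /andP[].
rewrite exprSr mulrACA ler_wpM2r//.
by rewrite mulr_ge0// addr_ge0.
Qed.

Lemma embeds_inducedE G s (H : graph 'I_s) f :
  embeds G (adj H) f = induced_iso G H (f @: [set: 'I_s]) f.
Proof. by rewrite /induced_iso eqxx. Qed.

(** Two isomorphisms from H onto the same induced subgraph differ by an
    automorphism of H. *)
Lemma card_induced_iso G s (H : graph 'I_s) U (f0 : {ffun 'I_s -> T}) :
  induced_iso G H U f0 ->
  #|[set f : {ffun 'I_s -> T} | induced_iso G H U f]| = #|graph_aut H|.
Proof.
move=> /and3P[/injectiveP inj0 /eqP im0 /forallP adj0].
have {}adj0 a b := eqP (forallP (adj0 a) b).
pose phi (p : {perm 'I_s}) := [ffun a => f0 (p a)].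
have phi_inj : injective phi.
  move=> p p' /ffunP pp'; apply/permP => a; apply: inj0.
  by have := pp' a; rewrite !ffunE.
rewrite -(card_imset _ phi_inj); apply: eq_card => f; rewrite inE; apply/idP/imsetP.
  move=> /and3P[/injectiveP injf /eqP imf /forallP adjf].
  have {}adjf a b := eqP (forallP (adjf a) b).
  have ex a : exists b, f0 b == f a.
    have : f a \in f0 @: [set: 'I_s] by rewrite im0 -imf imset_f.
    by case/imsetP => b _ ->; exists b.
  pose p0 a := xchoose (ex a).
  have p0E a : f0 (p0 a) = f a by apply/eqP/(xchooseP (ex a)).
  have p0_inj : injective p0 by move=> a b ab; apply: injf; rewrite -!p0E ab.
  exists (perm p0_inj); last by apply/ffunP => a; rewrite ffunE permE p0E.
  rewrite inE; apply/forallP => a; apply/forallP => b.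
  by rewrite !permE -adj0 !p0E adjf.
move=> [p]; rewrite inE => /forallP autp -> {f}.
have {}autp a b := eqP (forallP (autp a) b).
apply/and3P; split.
- by apply/injectiveP => a b; rewrite !ffunE => /inj0/perm_inj.
- rewrite -im0; apply/eqP/setP => w; apply/imsetP/imsetP => -[a _ ->].
    by exists (p a); rewrite ?ffunE.
  by exists (p^-1%g a); rewrite ?ffunE ?permKV.
- by apply/forallP => a; apply/forallP => b; rewrite !ffunE adj0 autp.
Qed.

Lemma card_embeddings G s (H : graph 'I_s) :
  \sum_f (embeds G (adj H) f)%:R = (induced_copies G H)%:R * #|graph_aut H|%:R :> R.
Proof.
rewrite -natrM -natr_sum; congr _%:R.
rewrite (partition_big (fun f : {ffun 'I_s -> T} => f @: [set: 'I_s]) xpredT)//=.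
rewrite /induced_copies -sum1_card big_distrl /= [RHS]big_mkcond /=; apply: eq_bigr => U _.
rewrite (eq_bigr (fun f => (induced_iso G H U f : nat))); last first.
  by move=> f /eqP <-; rewrite embeds_inducedE.
rewrite -big_mkcondr /= inE.
case: existsP => [[f0 f0P]|none].
  rewrite mul1n -(card_induced_iso f0P) -sum1_card; apply: eq_bigl => f.
  by rewrite inE andb_idl// => /and3P[].
by rewrite big1// => f /andP[_ fP]; case: none; exists f.
Qed.

End Embeddings.

Lemma bernoulli_ineq (R : realType) (x : R) n : 0 <= x -> x <= 1 ->
  1 - n%:R * x <= (1 - x) ^+ n.
Proof.
move=> x0 x1; elim: n => [|n IH]; first by rewrite mul0r subr0 expr0.
have h := ler_wpM2r (_ : 0 <= 1 - x) IH; rewrite exprSr; apply: le_trans (h _); last by lra.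
have n0 : 0 <= n%:R * x ^+ 2 by rewrite mulr_ge0 ?sqr_ge0.
by rewrite -natr1; move: n0; rewrite expr2; lra.
Qed.

(** The number of embeddings of H is #|Aut H| times the number of copies, so the
    bounds on embeddings are bounds on the ratio in [copies_error]; the factors
    (1 - eta) ^ s and (1 + eta) ^ s are then linearised. *)
Lemma regular_copies_error (R : realType) n (t eta : R) m (G : graph 'I_n) s (H : graph 'I_s) :
    ~~ irregular t m G -> 0 <= eta -> eta <= 1 ->
    (forall i, (i < s)%N -> t <= eta * ((n%:R - i%:R) * 2^-1 ^+ i)) ->
    (s <= m.+1)%N -> (s <= n)%N -> s%:R * eta <= 2^-1 ->
  copies_error R G H <= 2 * (s%:R * eta).
Proof.
move=> reg e0 e1 tP sm sn se.
have := @embeddings_bounds _ R t eta m G s (adj H) reg e0 e1.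
rewrite card_ord => /(_ tP sm sn (adjC _) (adj_irr _)).
have := @expected_embeddings_gt0 'I_n R s; rewrite card_ord => /(_ sn).
rewrite card_embeddings; set mu := expected_embeddings _ _ _ => mu0 /andP[lo hi].
have a0 : 0 < #|graph_aut H|%:R :> R.
  rewrite ltr0n; apply/card_gt0P; exists 1%g; rewrite inE.
  by apply/forallP => a; apply/forallP => b; rewrite !perm1.
have -> : copies_error R G H =
    `|(induced_copies G H)%:R * #|graph_aut H|%:R / mu - 1|.
  rewrite /copies_error; congr `|_ - 1|; rewrite /mu /expected_embeddings card_ord.
  have f0 : (n ^_ s)%:R != 0 :> R by rewrite pnatr_eq0 -lt0n ffact_gt0.
  have p0 : 2^-1 ^+ 'C(s, 2) != 0 :> R by rewrite expf_neq0.
  move: p0 f0 (lt0r_neq0 a0); set X := 2^-1 ^+ _; set Y := (n ^_ s)%:R.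
  by move=> p0 f0 q0; field; rewrite p0 f0 q0.
set Z := _ * #|_|%:R in lo hi *.
have se0 : 0 <= s%:R * eta by rewrite mulr_ge0.
have hi' : (1 + eta) ^+ s <= 1 + 2 * (s%:R * eta).
  apply: (@le_trans _ _ (expR (s%:R * eta))).
    by rewrite expRM_natl lerXn2r ?nnegrE ?expR_ge0 ?addr_ge0 ?expR_ge1Dx.
  by apply: le_trans (expR_le_quad se) _; rewrite expr2; nra.
have lo' := bernoulli_ineq s e0 e1.
have hiZ : Z / mu <= (1 + eta) ^+ s by rewrite ler_pdivrMr// mulrC.
have loZ : (1 - eta) ^+ s <= Z / mu by rewrite ler_pdivlMr// mulrC.
by rewrite ler_norml; apply/andP; split; lra.
Qed.

(** * Asymptotics *)

Section Asymptotics.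
Variable R : realType.

Lemma near_ler_powR (M th : R) : 0 < th -> \forall n \near \oo, M <= n%:R `^ th.
Proof.
move=> th0; near=> n.
have n1 : Num.max M 1 `^ th^-1 <= n%:R by near: n; exact: nbhs_infty_ger.
have M1 : 1 <= Num.max M 1 by rewrite le_max lexx orbT.
apply: (@le_trans _ _ (Num.max M 1)); first by rewrite le_max lexx.
have -> : Num.max M 1 = (Num.max M 1 `^ th^-1) `^ th.
  by rewrite -powRrM mulVf ?lt0r_neq0// powRr1// (le_trans ler01).
by rewrite ge0_ler_powR ?nnegrE ?powR_ge0// ltW.
Unshelve. all: by end_near. Qed.

Lemma near_ler_ln (M : R) : \forall n \near \oo, M <= ln n%:R.
Proof.
near=> n; have nM : expR M <= n%:R by near: n; exact: nbhs_infty_ger.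
by rewrite -(expRK M) ler_ln// posrE ?expR_gt0// (lt_le_trans (expR_gt0 M)).
Unshelve. all: by end_near. Qed.

(** With th = (b - a) / 4 one has th ln n <= n ^ th, so (ln n) ^ 2 is at most
    n ^ (2 th) / th ^ 2, which leaves a spare factor n ^ (2 th). *)
Lemma near_powR_ln2_le (D e a b : R) : 0 <= D -> 0 < e -> a < b ->
  \forall n \near \oo, D * (n%:R `^ a * ln n%:R ^+ 2) <= e * n%:R `^ b.
Proof.
move=> D0 e0 ab; pose th := (b - a) / 4; have th0 : 0 < th by rewrite divr_gt0//; lra.
have bE : b = a + (2 * th + 2 * th) by rewrite /th; lra.
have {}e0 : 0 < th ^+ 2 * e by rewrite mulr_gt0// exprn_gt0.
clearbody th.
near=> n.
have n1 : 1 <= n%:R :> R by near: n; exact: nbhs_infty_ger.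
have nth : D / (th ^+ 2 * e) <= n%:R `^ (2 * th).
  by near: n; apply: near_ler_powR; rewrite mulr_gt0.
have n0 : 0 < n%:R :> R by lra.
have ln0 : 0 <= ln n%:R :> R by rewrite ln_ge0.
have lnth : th * ln n%:R <= n%:R `^ th.
  have := expR_ge1Dx (th * ln n%:R); rewrite /powR gt_eqF//; lra.
have ln2 : th ^+ 2 * ln n%:R ^+ 2 <= n%:R `^ (2 * th).
  rewrite -exprMn [2 * th]mulrC powRrM powR_mulrn ?powR_ge0//.
  by rewrite lerXn2r ?nnegrE ?powR_ge0// mulr_ge0// ltW.
have th20 : 0 < th ^+ 2 by rewrite exprn_gt0.
have -> : n%:R `^ b = n%:R `^ a * (n%:R `^ (2 * th) * n%:R `^ (2 * th)).
  by rewrite -!powRD ?(lt0r_neq0 n0) ?implybT// bE.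
rewrite mulrCA [leRHS]mulrCA ler_wpM2l ?powR_ge0//.
rewrite -(ler_pM2l th20) mulrCA.
rewrite ler_pdivrMr// in nth.
set P := n%:R `^ (2 * th) in nth ln2 *.
have P0 : 0 <= P by exact: powR_ge0.
apply: (@le_trans _ _ (D * P)); first by rewrite ler_wpM2l.
have -> : th ^+ 2 * (e * (P * P)) = P * (th ^+ 2 * e) * P by ring.
by rewrite ler_wpM2r.
Unshelve. all: by end_near. Qed.

Lemma near_powR_le (D e a b : R) : 0 <= D -> 0 < e -> a < b ->
  \forall n \near \oo, D * n%:R `^ a <= e * n%:R `^ b.
Proof.
move=> D0 e0 ab; near=> n.
apply: (@le_trans _ _ (D * (n%:R `^ a * ln n%:R ^+ 2))).
  rewrite ler_wpM2l// ler_peMr ?powR_ge0// exprn_ege1//.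
  by near: n; exact: near_ler_ln.
by near: n; exact: near_powR_ln2_le.
Unshelve. all: by end_near. Qed.

End Asymptotics.

Section ConditionalProbability.
Local Open Scope set_scope.
Local Open Scope ring_scope.
Variable R : realType.

(** In the application A, P and W are n ^ max (1/2 - eps, 0), n ^ delta and
    n ^ (2 delta - 1). The combinatorial factors amount to
    exp (12 l ^ 2 + (c + 1) A l), and the last hypothesis lets the Gaussian exponent
    absorb them together with one more factor n. *)
Lemma union_bound_le (n m k : nat) (A P W C c : R) :
    let l := ln n%:R in
    1 <= l -> ln 2 <= l -> m%:R <= 3 * l -> k%:R <= (c + 1) * A -> 0 < c -> 1 <= A ->
    0 < C -> (c + 1) * A <= C / 4 * P -> P ^+ 2 = W * n%:R ->
    (c + 14) * (A * l ^+ 2) <= C ^+ 2 / 128 * W ->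
  (m.+1 * (n * 2) ^ m * n ^ k)%:R * (2 * expR (- ((C / 2 * P - k%:R) ^+ 2 / (8 * n%:R))))
    <= 2 / n%:R.
Proof.
move=> l l1 l2 ml kA c0 A1 C0 AP PW lW.
have n0 : (0 < n)%N by rewrite lt0n; apply/eqP => n0; move: l1; rewrite /l n0 ln0// ler10.
have n0R : 0 < n%:R :> R by rewrite ltr0n.
have nE : n%:R = expR l :> R by rewrite lnK// posrE.
clearbody l.
have h1 : (m.+1 * (n * 2) ^ m)%:R <= expR (12 * l ^+ 2).
  apply: (@le_trans _ _ (((n * 2) ^ m * (n * 2) ^ m)%:R)).
    rewrite ler_nat leq_mul2r; apply/orP; right.
    apply: (@leq_trans (2 ^ m)); first exact: ltn_expl.
    by case: (m) => [|m'] //; rewrite leq_exp2r// leq_pmull.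
  rewrite -expnD natrX natrM nE -[2%:R](@lnK R) ?posrE// -expRD -expRM_natr ler_expR.
  rewrite natrD; have m0 : 0 <= m%:R :> R by [].
  have h : (l + ln 2) * (m%:R + m%:R) <= (l + l) * (3 * l + 3 * l).
    by apply: ler_pM; rewrite ?lerD ?addr_ge0 ?ln_ge0 ?ler1n//; lra.
  by apply: le_trans h _; rewrite expr2; lra.
have h2 : (n ^ k)%:R <= expR ((c + 1) * A * l).
  by rewrite natrX nE -expRM_natl ler_expR ler_wpM2r//; lra.
have h3 : 12 * l ^+ 2 + (c + 1) * A * l + l <= (c + 14) * (A * l ^+ 2).
  have l20 : l <= l ^+ 2 by rewrite expr2 ler_peMl//; lra.
  have Al : A * l <= A * l ^+ 2 by rewrite ler_wpM2l//; lra.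
  have Al2 : l ^+ 2 <= A * l ^+ 2 by rewrite ler_peMl// sqr_ge0.
  have cA : (c + 1) * (A * l) <= (c + 1) * (A * l ^+ 2) by rewrite ler_wpM2l//; lra.
  lra.
have h4 : C ^+ 2 / 128 * W <= (C / 2 * P - k%:R) ^+ 2 / (8 * n%:R).
  rewrite ler_pdivlMr ?mulr_gt0//.
  have -> : C ^+ 2 / 128 * W * (8 * n%:R) = (C / 4 * P) ^+ 2.
    by rewrite exprMn PW; field.
  have k0 : 0 <= k%:R :> R by [].
  by rewrite lerXn2r ?nnegrE; lra.
set B := (C / 2 * P - k%:R) ^+ 2 / (8 * n%:R) in h4 *; clearbody B.
rewrite natrM.
apply: (@le_trans _ _ (expR (12 * l ^+ 2) * expR ((c + 1) * A * l) * (2 * expR (- B)))).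
  by rewrite ler_wpM2r ?mulr_ge0 ?expR_ge0// ler_pM.
rewrite mulrCA -!expRD nE -expRN ler_wpM2l// ler_expR; lra.
Qed.

(** The exponent max (1/2 - eps, 0), rather than 1/2 - eps, also covers the case
    eps > 1/2, in which the clique size stays bounded. *)
Lemma irregular_unlikely (delta C c eps e : R) :
    2^-1 < delta -> delta < 1 -> 0 < C -> 0 < c -> 1 < delta + eps -> 0 < e ->
  \forall n \near \oo,
    er_cprob 2^-1
      [set G : graph 'I_n | irregular (C / 2 * n%:R `^ delta) (Num.truncn (ln n%:R : R)).+2 G]
      (clique_event n (c * n%:R `^ (2^-1 - eps))) <= e.
Proof.
move=> delta_gt delta_lt C_gt0 c_gt0 delta_eps e0.
pose a : R := Num.max (2^-1 - eps) 0.
have a0 : 0 <= a by rewrite le_max lexx orbT.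
have ea : 2^-1 - eps <= a by rewrite le_max lexx.
have ab : a < 2 * delta - 1 by rewrite gt_max; apply/andP; split; lra.
clearbody a.
near=> n.
have n1 : 1 <= n%:R :> R by near: n; exact: nbhs_infty_ger.
have n0R : 0 < n%:R :> R by rewrite (lt_le_trans ltr01).
have n0 : (0 < n)%N by rewrite -(ltr_nat R).
have n2e : 2 / e <= n%:R :> R by near: n; exact: nbhs_infty_ger.
have l1 : 1 <= ln n%:R :> R by near: n; exact: near_ler_ln.
have l2 : ln 2 <= ln n%:R :> R by near: n; exact: near_ler_ln.
have mle : (Num.truncn (ln n%:R : R)).+2%:R <= 3 * ln n%:R :> R.
  have l0 : 0 <= ln n%:R :> R by rewrite (le_trans ler01).
  have /andP[h _] := truncn_itv l0.
  by rewrite -[_.+2]addn2 natrD; move: h l1; set x := ln _; lra.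
have tn : C / 2 * n%:R `^ delta <= 2 * n%:R `^ 1 :> R.
  by near: n; apply: near_powR_le => //; rewrite divr_ge0// ltW.
have kt2 : (c + 1) * n%:R `^ a <= C / 4 * n%:R `^ delta.
  by near: n; apply: near_powR_le; [lra | rewrite divr_gt0 | lra].
have expo : (c + 14) * (n%:R `^ a * ln n%:R ^+ 2) <= C ^+ 2 / 128 * n%:R `^ (2 * delta - 1).
  by near: n; apply: near_powR_ln2_le; [lra | rewrite divr_gt0 ?exprn_gt0 | ].
rewrite (powRr1 (ltW n0R)) in tn.
have na1 : 1 <= n%:R `^ a by rewrite -[leLHS](powRr0 n%:R) ler_powR.
have r0 : 0 <= c * n%:R `^ (2^-1 - eps) by rewrite mulr_ge0 ?powR_ge0// ltW.
have [k rk kr] := exists_nat_ceil r0.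
have kn : k%:R <= (c + 1) * n%:R `^ a.
  apply: le_trans (ltW kr) _; rewrite mulrDl mul1r lerD// ler_wpM2l ?ler_powR//.
  exact: ltW.
have PW : (n%:R `^ delta) ^+ 2 = n%:R `^ (2 * delta - 1) * n%:R :> R.
  rewrite -[X in _ * X](powRr1 (ltW n0R)) -powRD ?(lt0r_neq0 n0R) ?implybT//.
  by rewrite subrK [2 * _]mulrC powRrM powR_mulrn ?powR_ge0.
have nd0 : 0 <= n%:R `^ delta by exact: powR_ge0.
apply: (@le_trans _ _ (2 / n%:R)); last first.
  by rewrite ler_pdivrMr// -ler_pdivrMl// mulrC.
move: (n%:R `^ delta) (n%:R `^ a) (n%:R `^ (2 * delta - 1)) tn kt2 expo na1 kn PW nd0.
move=> P A W tn kt2 expo na1 kn PW nd0.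
have k0 : 0 <= k%:R :> R by [].
have kt' : k%:R <= C / 2 * P by clear -kn kt2 k0; lra.
have tk : C / 2 * P - k%:R <= 2 * n%:R by clear -tn k0; lra.
apply: le_trans (cprob_irregular _ n0 rk kr kt' tk) _.
exact: (union_bound_le l1 l2 mle kn c_gt0 na1 C_gt0 kt2 PW expo).
Unshelve. all: by end_near. Qed.

End ConditionalProbability.

(** * The conditional law *)

Section ConditionalLaw.
Local Open Scope set_scope.
Local Open Scope ring_scope.
Variables (R : realType) (n : nat).
Implicit Types A B D : {set graph 'I_n}.

Lemma er_cprob_half_ge0 A D : 0 <= er_cprob 2^-1 A D :> R.
Proof. by rewrite er_cprob_half divr_ge0. Qed.

Lemma er_cprob_half_le A B D :
  A \subset B -> er_cprob 2^-1 A D <= er_cprob 2^-1 B D :> R.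
Proof.
by move=> AB; rewrite !er_cprob_half ler_wpM2r ?invr_ge0// ler_nat subset_leq_card// finset.setSI.
Qed.

Lemma er_cprob_half_compl A D : D != finset.set0 ->
  er_cprob 2^-1 (~: A) D = 1 - er_cprob 2^-1 A D :> R.
Proof.
rewrite -card_gt0 => D0; rewrite !er_cprob_half -(cardsID A D) finset.setDE.
rewrite ![_ :&: D]finset.setIC natrD.
have : #|D :&: A|%:R + #|D :&: ~: A|%:R != 0 :> R.
  by rewrite -natrD pnatr_eq0 -finset.setDE cardsID -lt0n.
by move=> h; field.
Qed.

Lemma clique_event_neq0 (r : R) : r <= n%:R -> clique_event n r != finset.set0.
Proof.
move=> rn; apply/finset.set0Pn; exists [set: edge 'I_n]; rewrite inE.
apply: le_trans rn _; rewrite ler_nat; apply/clique_number_geP.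
exists [set: 'I_n]; last by rewrite cardsT card_ord.
apply/forallP => x; apply/implyP => _; apply/forallP => y; apply/implyP => _.
by apply/implyP => /edge_exists[e Ee]; rewrite (adjE _ Ee) inE.
Qed.

End ConditionalLaw.

Section SmallSubgraphs.
Variable R : realType.

Lemma ln2_ge_half : 2^-1 <= ln 2 :> R.
Proof.
rewrite -(expRK 2^-1) ler_ln ?posrE ?expR_gt0//.
by apply: le_trans (expR_le_quad (lexx _)) _; rewrite expr2; lra.
Qed.

(** With C0 = 2 / ln 2, the bound on s reads 2 ^ s <= n ^ (1 - delta) / (ln n) ^ 2.
    Since n - i >= n / 2 for i <= s, a deviation (C / 2) n ^ delta is then at most
    C / (ln n) ^ 2 times (n - i) / 2 ^ i. As s <= ln n, the accumulated error is
    O (1 / ln n). *)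
Lemma near_max_copies_error (delta C eta : R) :
    2^-1 < delta -> delta < 1 -> 0 < C -> 0 < eta ->
  \forall n \near \oo, forall G : graph 'I_n,
    ~~ irregular (C / 2 * n%:R `^ delta) (Num.truncn (ln n%:R : R)).+2 G ->
    max_copies_error
      (Num.min (1 - delta) 2^-1 * (ln n%:R / ln 2) - 2 / ln 2 * ln (ln n%:R)) G < eta.
Proof.
move=> d2 d1 C0 eta0; have ln2 := ln2_ge_half.
have -> : Num.min (1 - delta) 2^-1 = 1 - delta by rewrite min_l//; lra.
near=> n => G reg.
have l1 : 1 <= ln n%:R :> R by near: n; exact: near_ler_ln.
have l2C : 2 * C <= ln n%:R :> R by near: n; exact: near_ler_ln.
have l4C : 4 * C / eta <= ln n%:R :> R by near: n; exact: near_ler_ln.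
have l_n : 1 * (n%:R `^ 0 * ln n%:R ^+ 2) <= 2^-1 * n%:R `^ 1 :> R.
  by near: n; apply: near_powR_ln2_le.
have n0 : 0 < n%:R :> R.
  rewrite ltr0n lt0n; apply: contraTneq l1 => ->; rewrite ln0// -ltNge; exact: ltr01.
rewrite powRr0 !mul1r (powRr1 (ltW n0)) in l_n.
have nd : n%:R `^ delta * n%:R `^ (1 - delta) = n%:R :> R.
  rewrite -powRD ?(lt0r_neq0 n0) ?implybT//.
  by rewrite addrC subrK powRr1// ltW.
have n1dE : n%:R `^ (1 - delta) = expR ((1 - delta) * ln n%:R) :> R.
  by rewrite /powR (negbTE (lt0r_neq0 n0)).
have n1d0 : 0 < n%:R `^ (1 - delta) by rewrite powR_gt0.
move: (n%:R `^ delta) (n%:R `^ (1 - delta)) (ln n%:R) nd n1dE n1d0 l1 l2C l4C l_n reg.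
move=> P Q l PQ QE Q0 l1 l2C l4C l_n reg; have l0 : 0 < l by lra.
have ll0 : 0 <= ln l by rewrite ln_ge0.
set L := _ - _; have L_le : L * ln 2 = (1 - delta) * l - 2 * ln l.
  by rewrite /L; field; rewrite gt_eqF//; lra.
rewrite /max_copies_error big_nat_cond; apply: bigmax_lt => // s /andP[/andP[s1 sL] _].
apply: bigmax_lt => // H _.
have {}sL : s%:R <= L by rewrite -(prednK s1) -truncn_gt_nat prednK.
have sl : s%:R <= l.
  apply: le_trans sL _; rewrite -(@ler_pM2r _ (ln 2)); last by lra.
  rewrite L_le; apply: (@le_trans _ _ (2^-1 * l)); last by rewrite mulrC ler_wpM2l// ltW.
  have : (1 - delta) * l <= 2^-1 * l by rewrite ler_wpM2r ?ltW//; lra.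
  lra.
have pow_s : 2 ^+ s <= Q / l ^+ 2.
  rewrite -[2](@lnK R) ?posrE// -expRM_natl QE.
  have -> : l ^+ 2 = expR (2 * ln l) by rewrite expRM_natl lnK ?posrE.
  by rewrite -expRN -expRD ler_expR -L_le ler_wpM2r//; lra.
clear L L_le QE sL.
have l_sq : l <= l ^+ 2 by rewrite expr2 ler_peMl// ltW.
have l20 : 0 < l ^+ 2 by rewrite exprn_gt0.
have n_i i : (i <= s)%N -> n%:R / 2 <= n%:R - i%:R :> R.
  by rewrite -(ler_nat R) => h; lra.
pose e := C / l ^+ 2.
have e0 : 0 <= e by rewrite divr_ge0// ltW.
have le_e : l * e = C / l by rewrite /e; field; rewrite gt_eqF.
have Cl : C / l <= 2^-1 by rewrite ler_pdivrMr//; lra.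
have Cl' : 2 * (C / l) < eta.
  rewrite ler_pdivrMr// in l4C; rewrite mulrA ltr_pdivrMr// mulrC.
  by have := mulr_gt0 l0 eta0; lra.
have se : s%:R * e <= C / l by rewrite -le_e ler_wpM2r.
have e1 : e <= 1 by apply: (@le_trans _ _ (l * e)); [rewrite ler_peMl | lra].
have tP i : (i < s)%N -> C / 2 * P <= e * ((n%:R - i%:R) * 2^-1 ^+ i).
  move=> si; have pow_i : l ^+ 2 / Q <= 2^-1 ^+ i.
    rewrite exprVn -[_ / Q]invrK lef_pV2 ?posrE ?invr_gt0 ?divr_gt0 ?exprn_gt0//.
    rewrite invf_div; apply: le_trans pow_s; rewrite ler_weXn2l ?ler1n//; exact: ltnW.
  apply: (@le_trans _ _ (e * (n%:R / 2 * (l ^+ 2 / Q)))).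
    rewrite -PQ /e le_eqVlt; apply/orP; left; apply/eqP; field.
    by rewrite !gt_eqF.
  have n20 : 0 <= n%:R / 2 :> R by rewrite divr_ge0.
  have lQ : 0 <= l ^+ 2 / Q by rewrite divr_ge0 ?ltW.
  by rewrite ler_wpM2l//; apply: ler_pM => //; exact: n_i (ltnW si).
have sm : (s <= (Num.truncn l).+3)%N.
  by apply: (@leq_trans (Num.truncn l)); [rewrite truncn_ge_nat// ltW | rewrite -addn3 leq_addr].
have sn : (s <= n)%N by rewrite -(ler_nat R); lra.
have se2 : s%:R * e <= 2^-1 by apply: le_trans se Cl.
apply: le_lt_trans (regular_copies_error H reg e0 e1 tP sm sn se2) _.
by apply: le_lt_trans Cl'; rewrite ler_wpM2l.
Unshelve. all: by end_near. Qed.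

End SmallSubgraphs.

Theorem theorem2p7 (R : realType) (delta C c eps : R)
  (delta_gt : 2^-1 < delta) (delta_lt : delta < 1) (C_gt0 : 0 < C)
  (c_gt0 : 0 < c) (eps_gt0 : 0 < eps) (delta_eps : 1 < delta + eps) :
  let Cr (n : nat) := clique_event n (c * n%:R `^ (2^-1 - eps)) in
  (er_cprob 2^-1 (deg_event n delta C :|: codeg_event n delta C)%SET (Cr n)
     @[n --> \oo] --> (0 : R))
  /\
  exists2 C0 : R, 0 < C0 &
    let L (n : nat) :=
      Num.min (1 - delta) 2^-1 * (ln n%:R / ln 2) - C0 * ln (ln n%:R) in
    forall eta : R, 0 < eta ->
      er_cprob 2^-1
        [set G : graph 'I_n | max_copies_error (L n) G < eta]%SET (Cr n)
        @[n --> \oo] --> (1 : R).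
Proof.
move=> Cr; pose Irr n := [set G : graph 'I_n |
  irregular (C / 2 * n%:R `^ delta) (Num.truncn (ln n%:R : R)).+2 G]%SET.
have unlikely (e : R) : 0 < e -> \forall n \near \oo, er_cprob 2^-1 (Irr n) (Cr n) <= e.
  by move=> e0; apply: irregular_unlikely.
split.
  apply/cvgr0Pnorm_le => e e0; near=> n.
  rewrite ger0_norm ?er_cprob_half_ge0//.
  apply: (@le_trans _ _ (er_cprob 2^-1 (Irr n) (Cr n))); last first.
    by near: n; exact: unlikely.
  apply: er_cprob_half_le; apply/fintype.subsetP => G; apply: contraLR.
  rewrite inE => reg; apply: regular_degrees reg => //.
  have : 1 * n%:R `^ 0 <= C / 2 * n%:R `^ delta :> R.
    by near: n; apply: near_powR_le; rewrite ?divr_gt0//; lra.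
  by rewrite powRr0; set P := n%:R `^ delta; lra.
have ln2 := ln2_ge_half R.
exists (2 / ln 2); first by rewrite divr_gt0//; lra.
move=> L eta eta0; apply/cvgrPdist_le => e e0; near=> n.
have Cr0 : Cr n != finset.set0.
  apply: clique_event_neq0.
  have : c * n%:R `^ (2^-1 - eps) <= 1 * n%:R `^ 1 :> R.
    by near: n; apply: near_powR_le => //; lra.
  by rewrite mul1r powRr1.
set good := [set G | _]%SET.
have IrrS : (~: Irr n)%SET \subset good.
  apply/fintype.subsetP => G; rewrite !inE; move: G.
  by near: n; exact: near_max_copies_error.
have goodS : good \subset [set: graph 'I_n]%SET by exact: finset.subsetT.
have h1 := @er_cprob_half_le R n _ _ (Cr n) IrrS.
rewrite er_cprob_half_compl// in h1.
have h2 := @er_cprob_half_le R n _ _ (Cr n) goodS.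
have h3 : er_cprob 2^-1 [set: graph 'I_n]%SET (Cr n) = 1 :> R.
  by rewrite er_cprob_half finset.setTI divff// pnatr_eq0 cards_eq0.
rewrite h3 in h2; rewrite ger0_norm ?subr_ge0//.
have : er_cprob 2^-1 (Irr n) (Cr n) <= e by near: n; exact: unlikely.
lra.
Unshelve. all: by end_near. Qed.
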